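(* Let $K$ be a knot in $S^3$ with exterior $E_K$. For any irreducible metabelian representation $\rho'\colon\pi_1(E_K)\to\mathrm{SL}_2(\mathbb{C})$, the twisted Alexander polynomial $\Delta_{E_K}^{\alpha\otimes\rho'}(t)$ is a Laurent polynomial which consists of only even degree terms in $t$.
   Context: $E_K$ is the complement in $S^3$ of an open tubular neighbourhood of $K$. A representation $\rho'\colon\pi_1(E_K)\to\mathrm{SL}_2(\mathbb{C})$ is irreducible if $\rho'(\pi_1(E_K))$ has no proper invariant line in $\mathbb{C}^2$, and metabelian if $\rho'([\pi_1(E_K),\pi_1(E_K)])$ is abelian. Twisted Alexander polynomial (Wada): let $\pi_1(E_K)=\langle g_1,\dots,g_k\mid r_1,\dots,r_{k-1}\rangle$, let $\alpha\colon\pi_1(E_K)\to\langle t\rangle\simeq H_1(E_K;\mathbb{Z})$ be the abelianization, and let $\alpha(g_l)\ne1$. Let $\Phi_{\rho'}\colon\mathbb{Z}[\pi_1(E_K)]\to M_2(\mathbb{C}[t^{\pm1}])$ be the $\mathbb{Z}$-linear extension of $\gamma\mapsto\alpha(\gamma)\rho'(\gamma)$. Then $$\Delta_{E_K}^{\alpha\otimes\rho'}(t)=\frac{\det\big(\Phi_{\rho'}(\partial r_i/\partial g_j)\big)_{1\le i\le k-1,\;1\le j\le k,\;j\ne l}}{\det\Phi_{\rho'}(g_l-1)},$$ with $\partial r_i/\partial g_j$ the Fox derivatives. For $\mathrm{SL}_2(\mathbb{C})$-representations, this depends on the choice of presentation and of $g_l$ only up to a factor $\pm t^{2m}$, $m\in\mathbb{Z}$,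 so ''only even degree terms'' is meaningful. *)

(* Defs.v *)
From HB Require Import structures.
From mathcomp Require Import all_boot all_order all_algebra.
From mathcomp Require Import all_classical all_reals all_analysis.
From mathcomp Require Import generic_quotient homotopy complex ring lra.
From mathcomp.multinomials Require Import freeg.

Set Implicit Arguments.
Unset Strict Implicit.
Unset Printing Implicit Defensive.

Import Order.TTheory GRing.Theory Num.Theory.
Import numFieldNormedType.Exports.
Local Open Scope classical_set_scope.
Local Open Scope ring_scope.

Definition unit_interval (R : realType) : Type :=
  set_type (`[0, 1]%classic : set R).

Section UnitInterval.
Variable R : realType.
Local Notation I := (unit_interval R).

HB.instance Definition _ := Topological.on I.

Definition clampR (r : R) : R := Num.max 0 (Num.min 1 r).

Lemma clampR_in r : clampR r \in (`[0, 1]%classic : set R).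
Proof.
rewrite inE /= in_itv /= /clampR le_max lexx /= ge_max ler01 /=.
by rewrite ge_min lexx.
Qed.

Definition clamp (r : R) : I := exist _ (clampR r) (clampR_in r).

Definition valI (t : I) : R := val t.

Lemma valI_ge0 t : 0 <= valI t.
Proof. by case: t => r i; have := set_mem i; rewrite /= in_itv /= => /andP[]. Qed.

Lemma valI_le1 t : valI t <= 1.
Proof. by case: t => r i; have := set_mem i; rewrite /= in_itv /= => /andP[]. Qed.

Lemma clampK t : clamp (valI t) = t.
Proof.
apply: val_inj; rewrite /= /clampR min_r ?valI_le1// max_r ?valI_ge0//.
Qed.

Lemma valI_clamp r : 0 <= r <= 1 -> valI (clamp r) = r.
Proof.
by move=> /andP[r0 r1]; rewrite /valI /= /clampR min_r // max_r.
Qed.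

Lemma continuous_valI : continuous (valI : I -> R).
Proof. exact: initial_continuous. Qed.

Lemma continuous_clamp : continuous clamp.
Proof.
apply: continuous_comp_initial.
move=> r; rewrite /comp /=.
apply: (@continuous_max R R (fun=> 0) (fun r => Num.min 1 r) r).
  exact: cst_continuous.
by apply: (@continuous_min R R (fun=> 1) id r); [exact: cst_continuous|exact: cvg_id].
Qed.

Lemma clamp01 : clamp 0 != clamp 1.
Proof.
apply/eqP => /(congr1 valI); rewrite !valI_clamp ?lexx ?ler01// => /eqP.
by rewrite eq_sym oner_eq0.
Qed.

HB.instance Definition _ := isBiPointed.Build I clamp01.

Lemma valI_zero : valI (zero : I) = 0.
Proof. by rewrite [zero]/(clamp 0) valI_clamp // lexx ler01. Qed.

Lemma valI_one : valI (one : I) = 1.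
Proof. by rewrite [one]/(clamp 1) valI_clamp // lexx ler01. Qed.

End UnitInterval.

Section Pasting.
Variables (R : realType) (T X : topologicalType).

Lemma continuous_paste (h : T -> R) (c : R) (f g : T -> X) :
  continuous h -> continuous f -> continuous g ->
  (forall t, h t = c -> f t = g t) ->
  continuous (fun t => if h t <= c then f t else g t).
Proof.
move=> ch cf cg fg.
pose A := h @^-1` [set r | r <= c]; pose B := h @^-1` [set r | c <= r].
have cA : closed A by apply: closed_comp => [x _|]; [exact: ch|exact: closed_le].
have cB : closed B by apply: closed_comp => [x _|]; [exact: ch|exact: closed_ge].
apply/continuous_subspace_setT.
have -> : [set: T] = A `|` B.
  apply/seteqP; split=> // t _.
  by have [?|/ltW ?] := leP (h t) c; [left|right].
apply: withinU_continuous => //.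
  apply: (@subspace_eq_continuous _ _ _ f) => [t /set_mem At|].
    by rewrite /from_subspace ifT.
  exact: continuous_subspaceT.
apply: (@subspace_eq_continuous _ _ _ g) => [t /set_mem Bt|].
  rewrite /from_subspace; case: ifPn => // hc; apply/esym/fg/eqP.
  by rewrite eq_le hc.
exact: continuous_subspaceT.
Qed.

End Pasting.

Section FundamentalGroup.
Variables (R : realType) (X : topologicalType) (x0 : X).
Local Notation I := (unit_interval R).
Local Notation loop := {path I from x0 to x0 in X}.

(* Homotopy relative to the end points. *)
Definition loop_homotopic (p q : loop) : Prop :=
  exists H : I * I -> X,
    [/\ continuous H,
        (forall t, H (t, zero) = p t),
        (forall t, H (t, one) = q t) &
        (forall s, H (zero, s) = x0 /\ H (one, s) = x0)].

Lemma reparam_homotopic (w : R -> X) (f0 f1 : I -> R) (p q : loop) :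
  continuous w -> continuous f0 -> continuous f1 ->
  f0 zero = f1 zero -> f0 one = f1 one ->
  (forall t, p t = w (f0 t)) -> (forall t, q t = w (f1 t)) ->
  loop_homotopic p q.
Proof.
move=> cw cf0 cf1 e0 e1 pE qE.
have p0 : p zero = x0 := path_zero.
have p1 : p one = x0 := path_one.
exists (fun ts : I * I =>
  w ((1 - valI ts.2) * f0 ts.1 + valI ts.2 * f1 ts.1)); split.
- have c1 (f : I -> R) : continuous f -> continuous (fun ts : I * I => f ts.1).
    by move=> cf ts; apply: (@continuous_comp _ _ _ fst f);
      [exact: cvg_fst|exact: cf].
  have c2 : continuous (fun ts : I * I => valI ts.2).
    by move=> ts; apply: (@continuous_comp _ _ _ snd (@valI R));
      [exact: cvg_snd|exact: continuous_valI].
  move=> ts; apply: (@continuous_comp _ _ _ (fun ts : I * I =>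
    (1 - valI ts.2) * f0 ts.1 + valI ts.2 * f1 ts.1) w); last exact: cw.
  apply: continuousD; apply: continuousM; rewrite /continuous_at.
  + by apply: continuousB; [exact: cst_continuous|exact: c2].
  + exact: c1.
  + exact: c2.
  + exact: c1.
- by move=> t; rewrite /= valI_zero pE subr0 mul1r mul0r addr0.
- by move=> t; rewrite /= valI_one qE subrr mul1r mul0r add0r.
- move=> s; rewrite /= -e0 -e1 -!mulrDl subrK !mul1r -!pE.
  by split.
Qed.

Definition loop_ext (p : loop) (r : R) : X := p (clamp r).

Lemma loop_ext_continuous p : continuous (loop_ext p).
Proof.
move=> r; apply: (@continuous_comp _ _ _ (@clamp R) p).
  exact: continuous_clamp.
exact: cts_fun.
Qed.

Lemma loop_ext_valI p t : loop_ext p (valI t) = p t.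
Proof. by rewrite /loop_ext clampK. Qed.

Lemma loop_ext0 p : loop_ext p 0 = x0. Proof. exact: path_zero. Qed.
Lemma loop_ext1 p : loop_ext p 1 = x0. Proof. exact: path_one. Qed.

Lemma loop_homotopic_refl p : loop_homotopic p p.
Proof.
apply: (@reparam_homotopic (loop_ext p) (@valI R) (@valI R)) => //;
  rewrite ?loop_ext0 ?loop_ext1 //.
- exact: loop_ext_continuous.
- exact: continuous_valI.
- exact: continuous_valI.
- by move=> t; rewrite loop_ext_valI.
- by move=> t; rewrite loop_ext_valI.
Qed.

Definition loop_const_fun : I -> X := fun=> x0.

Lemma loop_const_continuous : continuous loop_const_fun.
Proof. exact: cst_continuous. Qed.

Definition loop_const : loop :=
  mk_path loop_const_continuous (erefl : loop_const_fun zero = x0) erefl.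

Definition loop_rev_fun (p : loop) : I -> X :=
  fun t => p (clamp (1 - valI t)).

Lemma loop_rev_continuous p : continuous (loop_rev_fun p).
Proof.
move=> t; apply: (@continuous_comp _ _ _ (fun t : I => 1 - valI t) (loop_ext p)).
  apply: continuousB; [exact: cst_continuous|exact: continuous_valI].
exact: loop_ext_continuous.
Qed.

Lemma loop_rev0 p : loop_rev_fun p zero = x0.
Proof. by rewrite /loop_rev_fun valI_zero subr0 -/(loop_ext _ _) loop_ext1. Qed.

Lemma loop_rev1 p : loop_rev_fun p one = x0.
Proof. by rewrite /loop_rev_fun valI_one subrr -/(loop_ext _ _) loop_ext0. Qed.

Definition loop_rev (p : loop) : loop :=
  mk_path (loop_rev_continuous (p:=p)) (loop_rev0 p) (loop_rev1 p).

Definition loop_cat_fun (p q : loop) : I -> X := fun t =>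
  if valI t <= 2^-1 then p (clamp (2 * valI t)) else q (clamp (2 * valI t - 1)).

Lemma loop_cat_continuous p q : continuous (loop_cat_fun p q).
Proof.
have c2 : continuous (fun t : I => 2 * valI t).
  by move=> t; apply: (@continuousM _ _ (fun=> 2) (@valI R));
    [exact: cst_continuous|exact: continuous_valI].
apply: continuous_paste => [|t|t|t ->].
- exact: continuous_valI.
- by apply: (@continuous_comp _ _ _ (fun t : I => 2 * valI t) (loop_ext p));
    [exact: c2|exact: loop_ext_continuous].
- apply: (@continuous_comp _ _ _ (fun t : I => 2 * valI t - 1) (loop_ext q)).
    by apply: continuousB; [exact: c2|exact: cst_continuous].
  exact: loop_ext_continuous.
- rewrite mulfV ?pnatr_eq0// subrr.
  by rewrite -/(loop_ext p 1) -/(loop_ext q 0) loop_ext0 loop_ext1.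
Qed.

Lemma loop_cat0 p q : loop_cat_fun p q zero = x0.
Proof.
rewrite /loop_cat_fun valI_zero mulr0 ifT ?invr_ge0 ?ler0n//.
exact: loop_ext0.
Qed.

Lemma loop_cat1 p q : loop_cat_fun p q one = x0.
Proof.
rewrite /loop_cat_fun valI_one mulr1 ifF; last by apply/negbTE; lra.
have -> : 2 - 1 = 1 :> R by lra.
exact: loop_ext1.
Qed.

Definition loop_cat (p q : loop) : loop :=
  mk_path (loop_cat_continuous (p:=p) (q:=q)) (loop_cat0 p q) (loop_cat1 p q).

Lemma square_snd_continuous (f : R -> R) :
  continuous f -> continuous (fun ts : I * I => f (valI ts.2)).
Proof.
move=> cf ts; apply: (@continuous_comp _ _ _ snd (fun s => f (valI s))).
  exact: cvg_snd.
by apply: (@continuous_comp _ _ _ (@valI R) f);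
  [exact: continuous_valI|exact: cf].
Qed.

Lemma square_fst_continuous (f : R -> R) :
  continuous f -> continuous (fun ts : I * I => f (valI ts.1)).
Proof.
move=> cf ts; apply: (@continuous_comp _ _ _ fst (fun s => f (valI s))).
  exact: cvg_fst.
by apply: (@continuous_comp _ _ _ (@valI R) f);
  [exact: continuous_valI|exact: cf].
Qed.

Lemma affine_continuous (a b : R) : continuous (fun r : R => a * r + b).
Proof.
move=> r; apply: continuousD; last exact: cst_continuous.
by apply: (@continuousM _ _ (fun=> a) id); [exact: cst_continuous|exact: cvg_id].
Qed.

Lemma square_reparam_continuous (H : I * I -> X) (u v : I * I -> R) :
  continuous H -> continuous u -> continuous v ->
  continuous (fun ts => H (clamp (u ts), clamp (v ts))).
Proof.
move=> cH cu cv ts.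
apply: (@continuous_comp _ _ _ (fun ts => (clamp (u ts), clamp (v ts))) H).
  have cl (w : I * I -> R) : continuous w -> {for ts, continuous (@clamp R \o w)}.
    by move=> cw; apply: continuous_comp; [exact: cw|exact: continuous_clamp].
  by apply: (@cvg_pair _ _ _ _ (nbhs (clamp (u ts))) (nbhs (clamp (v ts))));
    [exact: cl|exact: cl].
exact: cH.
Qed.

Lemma valI1_continuous : continuous (fun ts : I * I => valI ts.1).
Proof. by apply: (@square_fst_continuous id) => r; exact: cvg_id. Qed.

Lemma valI2_continuous : continuous (fun ts : I * I => valI ts.2).
Proof. by apply: (@square_snd_continuous id) => r; exact: cvg_id. Qed.

Lemma clamp0 : clamp 0 = zero :> I. Proof. by []. Qed.
Lemma clamp1 : clamp 1 = one :> I. Proof. by []. Qed.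

Lemma loop_homotopic_sym p q : loop_homotopic p q -> loop_homotopic q p.
Proof.
move=> [H [cH H0 H1 Hx]].
exists (fun ts => H (clamp (valI ts.1), clamp (-1 * valI ts.2 + 1))); split.
- apply: square_reparam_continuous => //; first exact: valI1_continuous.
  exact: (square_snd_continuous (@affine_continuous _ _)).
- by move=> t; rewrite /= clampK valI_zero mulr0 add0r.
- by move=> t; rewrite /= clampK valI_one mulr1 addNr.
- by move=> s; rewrite /= !clampK; exact: Hx.
Qed.

Lemma loop_homotopic_trans q p r :
  loop_homotopic p q -> loop_homotopic q r -> loop_homotopic p r.
Proof.
move=> [H [cH H0 H1 Hx]] [K [cK K0 K1 Kx]].
exists (fun ts => if valI ts.2 <= 2^-1
  then H (clamp (valI ts.1), clamp (2 * valI ts.2 + 0))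
  else K (clamp (valI ts.1), clamp (2 * valI ts.2 + -1))); split.
- apply: continuous_paste.
  + exact: valI2_continuous.
  + apply: square_reparam_continuous => //; first exact: valI1_continuous.
    exact: (square_snd_continuous (@affine_continuous _ _)).
  + apply: square_reparam_continuous => //; first exact: valI1_continuous.
    exact: (square_snd_continuous (@affine_continuous _ _)).
  + move=> ts ->; rewrite mulfV ?pnatr_eq0// subrr addr0 clampK.
    by rewrite clamp1 clamp0 H1 K0.
- move=> t; rewrite /= valI_zero ifT ?invr_ge0 ?ler0n// mulr0 addr0.
  by rewrite clampK.
- move=> t; rewrite /= valI_one ifF; last by apply/negbTE; lra.
  have -> : 2 * 1 + -1 = 1 :> R by lra.
  by rewrite clampK.
- by move=> s; rewrite /= !clampK; case: ifP => _; [exact: Hx|exact: Kx].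
Qed.

Lemma loop_cat_homotopic p p' q q' :
  loop_homotopic p p' -> loop_homotopic q q' ->
  loop_homotopic (loop_cat p q) (loop_cat p' q').
Proof.
move=> [H [cH H0 H1 Hx]] [K [cK K0 K1 Kx]].
exists (fun ts => if valI ts.1 <= 2^-1
  then H (clamp (2 * valI ts.1 + 0), clamp (valI ts.2))
  else K (clamp (2 * valI ts.1 + -1), clamp (valI ts.2))); split.
- apply: continuous_paste.
  + exact: valI1_continuous.
  + apply: square_reparam_continuous => //; last exact: valI2_continuous.
    exact: (square_fst_continuous (@affine_continuous _ _)).
  + apply: square_reparam_continuous => //; last exact: valI2_continuous.
    exact: (square_fst_continuous (@affine_continuous _ _)).
  + move=> ts ->; rewrite mulfV ?pnatr_eq0// subrr addr0 clampK.
    by rewrite clamp1 clamp0 (Hx _).2 (Kx _).1.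
- by move=> t; rewrite /= /mk_path /loop_cat_fun clampK addr0 H0 K0.
- by move=> t; rewrite /= /mk_path /loop_cat_fun clampK addr0 H1 K1.
- move=> s; rewrite /= !clampK valI_zero valI_one !mulr0 addr0.
  rewrite ifT ?invr_ge0 ?ler0n// ifF; last by apply/negbTE; lra.
  have -> : 2 * 1 + -1 = 1 :> R by lra.
  by rewrite clamp0 clamp1; split; [exact: (Hx s).1|exact: (Kx s).2].
Qed.

Lemma loop_rev_homotopic p q :
  loop_homotopic p q -> loop_homotopic (loop_rev p) (loop_rev q).
Proof.
move=> [H [cH H0 H1 Hx]].
exists (fun ts => H (clamp (-1 * valI ts.1 + 1), clamp (valI ts.2))); split.
- apply: square_reparam_continuous => //; last exact: valI2_continuous.
  exact: (square_fst_continuous (@affine_continuous _ _)).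
- by move=> t; rewrite /= /mk_path /loop_rev_fun clampK H0 mulN1r addrC.
- by move=> t; rewrite /= /mk_path /loop_rev_fun clampK H1 mulN1r addrC.
- move=> s; rewrite /= clampK valI_zero valI_one mulr0 add0r mulN1r addNr.
  by rewrite clamp0 clamp1; split; [exact: (Hx s).2|exact: (Hx s).1].
Qed.

Lemma loop_ext_cat p q r : 0 <= r <= 1 -> loop_ext (loop_cat p q) r =
  if r <= 2^-1 then loop_ext p (2 * r) else loop_ext q (2 * r - 1).
Proof.
by move=> r01; rewrite /loop_ext /= /mk_path /loop_cat_fun valI_clamp.
Qed.

Lemma loop_catE p q t : loop_cat p q t =
  if valI t <= 2^-1 then loop_ext p (2 * valI t) else loop_ext q (2 * valI t - 1).
Proof. by []. Qed.

Let affineI (a b : R) : continuous (fun t : I => a * valI t + b).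
Proof.
move=> t; apply: (@continuous_comp _ _ _ (@valI R) (fun r => a * r + b)).
  exact: continuous_valI.
exact: affine_continuous.
Qed.

Let minI (f g : I -> R) : continuous f -> continuous g ->
  continuous (fun t => Num.min (f t) (g t)).
Proof. by move=> cf cg t; apply: continuous_min; [exact: cf|exact: cg]. Qed.

Let maxI (f g : I -> R) : continuous f -> continuous g ->
  continuous (fun t => Num.max (f t) (g t)).
Proof. by move=> cf cg t; apply: continuous_max; [exact: cf|exact: cg]. Qed.

Lemma loop_catA p q r :
  loop_homotopic (loop_cat p (loop_cat q r)) (loop_cat (loop_cat p q) r).
Proof.
apply: (@reparam_homotopic (loop_ext (loop_cat p (loop_cat q r))) (@valI R)
  (fun t => Num.min (2 * valI t + 0)
     (Num.min (1 * valI t + 4^-1) (2^-1 * valI t + 2^-1)))).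
- exact: loop_ext_continuous.
- exact: continuous_valI.
- by apply: minI; [exact: affineI|apply: minI; exact: affineI].
- by rewrite valI_zero !mulr0 !add0r minEle ifT // le_min; lra.
- by rewrite valI_one [X in Num.min _ X]min_r ?min_r; lra.
- by move=> t; rewrite loop_ext_valI.
- move=> t; have t0 := valI_ge0 t; have t1 := valI_le1 t.
  rewrite loop_catE; have [th|th] := leP (valI t) (2^-1).
    rewrite [X in Num.min _ X]min_l; last by lra.
    rewrite loop_ext_cat; last by lra.
    have [th4|th4] := leP (2 * valI t) (2^-1).
      rewrite min_l; last by lra.
      by rewrite loop_ext_cat ?ifT ?addr0//; lra.
    rewrite min_r; last by lra.
    rewrite loop_ext_cat; last by lra.
    rewrite ifF; last by apply/negbTE; lra.
    rewrite loop_ext_cat; last by lra.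
    by rewrite ifT; [congr loop_ext; lra|lra].
  rewrite [X in Num.min _ X]min_r; last by lra.
  rewrite min_r; last by lra.
  rewrite loop_ext_cat; last by lra.
  rewrite ifF; last by apply/negbTE; lra.
  rewrite loop_ext_cat; last by lra.
  rewrite ifF; last by apply/negbTE; lra.
  by congr loop_ext; lra.
Qed.

Lemma loop_cat1l p : loop_homotopic (loop_cat loop_const p) p.
Proof.
apply: (@reparam_homotopic (loop_ext p)
  (fun t => Num.max (0 * valI t + 0) (2 * valI t + -1)) (@valI R)).
- exact: loop_ext_continuous.
- by apply: maxI; exact: affineI.
- exact: continuous_valI.
- by rewrite valI_zero !mulr0 !add0r max_l; lra.
- by rewrite valI_one max_r; lra.
- move=> t; rewrite loop_catE mul0r addr0; case: ifPn => th.
    by rewrite max_l ?loop_ext0//; lra.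
  by rewrite max_r //; move: th; rewrite -ltNge; lra.
- by move=> t; rewrite loop_ext_valI.
Qed.

Lemma loop_cat1r p : loop_homotopic (loop_cat p loop_const) p.
Proof.
apply: (@reparam_homotopic (loop_ext p)
  (fun t => Num.min (0 * valI t + 1) (2 * valI t + 0)) (@valI R)).
- exact: loop_ext_continuous.
- by apply: minI; exact: affineI.
- exact: continuous_valI.
- by rewrite valI_zero !mulr0 !add0r min_r.
- by rewrite valI_one min_l; lra.
- move=> t; rewrite loop_catE mul0r add0r addr0; case: ifPn => th.
    by rewrite min_r //; lra.
  by rewrite min_l ?loop_ext1//; move: th; rewrite -ltNge; lra.
- by move=> t; rewrite loop_ext_valI.
Qed.

Lemma loop_ext_rev p r : 0 <= r <= 1 -> loop_ext (loop_rev p) r = loop_ext p (1 - r).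
Proof. by move=> r01; rewrite /loop_ext /= /mk_path /loop_rev_fun valI_clamp. Qed.

Lemma loop_catV p : loop_homotopic (loop_cat p (loop_rev p)) loop_const.
Proof.
apply: (@reparam_homotopic (loop_ext p)
  (fun t => Num.min (2 * valI t + 0) (-2 * valI t + 2))
  (fun t => 0 * valI t + 0)).
- exact: loop_ext_continuous.
- by apply: minI; exact: affineI.
- exact: affineI.
- by rewrite valI_zero !mulr0 !add0r min_l.
- by rewrite valI_one min_r; lra.
- move=> t; have t0 := valI_ge0 t; have t1 := valI_le1 t.
  rewrite loop_catE; have [th|th] := leP (valI t) (2^-1).
    by rewrite min_l ?addr0//; lra.
  rewrite min_r; last by lra.
  by rewrite loop_ext_rev; [congr loop_ext; lra|lra].
- by move=> t; rewrite mul0r addr0 loop_ext0.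
Qed.

Lemma loop_catVl p : loop_homotopic (loop_cat (loop_rev p) p) loop_const.
Proof.
apply: (@reparam_homotopic (loop_ext p)
  (fun t => Num.max (-2 * valI t + 1) (2 * valI t + -1))
  (fun t => 0 * valI t + 1)).
- exact: loop_ext_continuous.
- by apply: maxI; exact: affineI.
- exact: affineI.
- by rewrite valI_zero !mulr0 !add0r max_l; lra.
- by rewrite valI_one max_r; lra.
- move=> t; have t0 := valI_ge0 t; have t1 := valI_le1 t.
  rewrite loop_catE; have [th|th] := leP (valI t) (2^-1).
    rewrite max_l; last by lra.
    by rewrite loop_ext_rev; [congr loop_ext; lra|lra].
  by rewrite max_r //; lra.
- by move=> t; rewrite mul0r add0r loop_ext1.
Qed.

Local Open Scope quotient_scope.

Let homr : rel loop := fun p q => `[< loop_homotopic p q >].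

Let homr_refl : reflexive homr.
Proof. by move=> p; apply/asboolP; exact: loop_homotopic_refl. Qed.

Let homr_sym : symmetric homr.
Proof. by move=> p q; apply: asbool_equiv_eq; split; exact: loop_homotopic_sym. Qed.

Let homr_trans : transitive homr.
Proof.
move=> q p r /asboolP pq /asboolP qr; apply/asboolP.
exact: loop_homotopic_trans pq qr.
Qed.

Definition loop_homotopy_rel := EquivRel homr homr_refl homr_sym homr_trans.

Definition fundamental_group : Type := {eq_quot loop_homotopy_rel}.

HB.instance Definition _ := Choice.on fundamental_group.

Definition loop_class (p : loop) : fundamental_group :=
  \pi_{eq_quot loop_homotopy_rel} p.

Definition loop_repr (a : fundamental_group) : loop :=
  repr (a : {eq_quot loop_homotopy_rel}).

Lemma loop_reprK a : loop_class (loop_repr a) = a.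
Proof. exact: reprK. Qed.

Lemma loop_classP p q : loop_class p = loop_class q <-> loop_homotopic p q.
Proof.
split=> [/eqquotP/asboolP //|pq].
exact/eqquotP/asboolP.
Qed.

Lemma loop_repr_class p : loop_homotopic (loop_repr (loop_class p)) p.
Proof. exact/loop_classP/loop_reprK. Qed.

Definition pi1_mul (a b : fundamental_group) : fundamental_group :=
  loop_class (loop_cat (loop_repr a) (loop_repr b)).

Definition pi1_inv (a : fundamental_group) : fundamental_group :=
  loop_class (loop_rev (loop_repr a)).

Definition pi1_one : fundamental_group := loop_class loop_const.

Lemma pi1_mulE p q :
  pi1_mul (loop_class p) (loop_class q) = loop_class (loop_cat p q).
Proof. by apply/loop_classP/loop_cat_homotopic; exact: loop_repr_class. Qed.

Lemma pi1_invE p : pi1_inv (loop_class p) = loop_class (loop_rev p).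
Proof. by apply/loop_classP/loop_rev_homotopic; exact: loop_repr_class. Qed.

Lemma pi1_mulA : associative pi1_mul.
Proof.
move=> a b c; rewrite -(loop_reprK a) -(loop_reprK b) -(loop_reprK c) !pi1_mulE.
exact/loop_classP/loop_catA.
Qed.

Lemma pi1_mul1g : left_id pi1_one pi1_mul.
Proof. by move=> a; rewrite -(loop_reprK a) pi1_mulE; exact/loop_classP/loop_cat1l. Qed.

Lemma pi1_mulg1 : right_id pi1_one pi1_mul.
Proof. by move=> a; rewrite -(loop_reprK a) pi1_mulE; exact/loop_classP/loop_cat1r. Qed.

Lemma pi1_mulVg : left_inverse pi1_one pi1_inv pi1_mul.
Proof.
move=> a; rewrite -(loop_reprK a) pi1_invE pi1_mulE.
exact/loop_classP/loop_catVl.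
Qed.

Lemma pi1_mulgV : right_inverse pi1_one pi1_inv pi1_mul.
Proof.
move=> a; rewrite -(loop_reprK a) pi1_invE pi1_mulE.
exact/loop_classP/loop_catV.
Qed.

HB.instance Definition _ := isGroup.Build fundamental_group
  pi1_mulA pi1_mul1g pi1_mulg1 pi1_mulVg pi1_mulgV.

End FundamentalGroup.


Section Knots.
Variable R : realType.

Definition norm2 n (x : 'rV[R]_n) : R := \sum_i x 0 i ^+ 2.

Definition sphere n : Type := set_type [set x : 'rV[R]_n.+1 | norm2 x = 1].

HB.instance Definition _ n := Topological.on (sphere n).

Definition topological_embedding (S T : topologicalType) (f : S -> T) : Prop :=
  [/\ injective f, continuous f &
      forall A : set S, open A -> exists2 B : set T, open B & f @` A = B `&` range f].

Definition is_knot (K : set (sphere 3)) : Prop :=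
  exists2 f : sphere 1 -> sphere 3, topological_embedding f & K = range f.

(* Embedding the whole of S^1 x R^2, and not just S^1 x D^2, makes the closure
   of U a tame solid torus; a set K admitting such a U is a tame knot. *)
Definition is_open_tubular_neighbourhood (K U : set (sphere 3)) : Prop :=
  exists f : sphere 1 * 'rV[R]_2 -> sphere 3,
    [/\ topological_embedding f,
        K = f @` [set p | p.2 = 0] &
        U = f @` [set p | norm2 p.2 < 1]].

Definition knot_exterior (U : set (sphere 3)) : Type := set_type (~` U).

HB.instance Definition _ U := Topological.on (knot_exterior U).

End Knots.

Section GroupTheory.
Variable G : groupType.
Local Open Scope group_scope.

Inductive commutator_subgroup : G -> Prop :=
| commutator_subgroup_comm x y : commutator_subgroup [~ x, y]
| commutator_subgroup1 : commutator_subgroup 1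
| commutator_subgroupM x y : commutator_subgroup x -> commutator_subgroup y ->
    commutator_subgroup (x * y)
| commutator_subgroupV x : commutator_subgroup x -> commutator_subgroup x^-1.

(* alpha x stands for the exponent of t in the image of x in <t> = H_1. *)
Definition is_abelianization (alpha : G -> int) : Prop :=
  [/\ forall x y, alpha (x * y) = (alpha x + alpha y)%R,
      forall n, exists x, alpha x = n &
      forall x, alpha x = 0%R <-> commutator_subgroup x].

End GroupTheory.

(* Words in the generators and their inverses, (i, false) standing for g_i and
   (i, true) for g_i^-1. They represent the elements of the free group. *)
Definition word (k : nat) : Type := seq ('I_k * bool).

Definition letter_inv k (a : 'I_k * bool) : 'I_k * bool := (a.1, ~~ a.2).

Definition word_inv k (w : word k) : word k := rev (map (@letter_inv k) w).

(* The words whose class in the free group lies in the normal closure of the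
   relators: normal_closure_insert and normal_closure_cancel say that
   membership only depends on that class. *)
Inductive normal_closure k m (r : 'I_m -> word k) : word k -> Prop :=
| normal_closure_relator i : normal_closure r (r i)
| normal_closure_nil : normal_closure r [::]
| normal_closure_cat u v : normal_closure r u -> normal_closure r v ->
    normal_closure r (u ++ v)
| normal_closure_inv u : normal_closure r u -> normal_closure r (word_inv u)
| normal_closure_conj u v : normal_closure r u ->
    normal_closure r (v ++ u ++ word_inv v)
| normal_closure_insert u v a : normal_closure r (u ++ v) ->
    normal_closure r (u ++ a :: letter_inv a :: v)
| normal_closure_cancel u v a : normal_closure r (u ++ a :: letter_inv a :: v) ->
    normal_closure r (u ++ v).

Section Presentations.
Variables (G : groupType) (k : nat) (g : 'I_k -> G).
Local Open Scope group_scope.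

Definition eval_letter (a : 'I_k * bool) : G :=
  if a.2 then (g a.1)^-1 else g a.1.

Fixpoint eval_word (w : word k) : G :=
  if w is a :: w' then eval_letter a * eval_word w' else 1.

Definition is_presentation m (r : 'I_m -> word k) : Prop :=
  (forall x, exists w, eval_word w = x) /\
  (forall w, eval_word w = 1 <-> normal_closure r w).

End Presentations.

Section GroupRing.
Variable G : groupType.

(* The underlying abelian group of Z[G] is the free abelian group on G. *)
Local Notation group_ring := {freeg G / int}.

Definition gring_of (x : G) : group_ring := << x >>.

HB.instance Definition _ (M : lmodType int) (f : G -> M) :=
  GRing.isZmodMorphism.Build group_ring M (fglift f) (lift_is_additive f).

(* The Z-linear extension of f : G -> M. *)
Definition gring_lift (M : zmodType) (f : G -> M) (c : group_ring) : M :=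
  \sum_(x <- dom c) f x *~ coeff x c.

Lemma gring_liftE (M : zmodType) (f : G -> M) (c : group_ring) :
  gring_lift f c = fglift (f : G -> zmodule M) c.
Proof.
rewrite -[in RHS](freeg_sumE c) raddf_sum; apply: eq_bigr => x _.
by rewrite /= liftU.
Qed.

Lemma gring_lift_of (M : zmodType) (f : G -> M) x :
  gring_lift f (gring_of x) = f x.
Proof. by rewrite gring_liftE liftU scale1r. Qed.

Lemma gring_lift_is_additive (M : zmodType) (f : G -> M) :
  additive (gring_lift f).
Proof. by move=> c d; rewrite !gring_liftE raddfB. Qed.

HB.instance Definition _ (M : zmodType) (f : G -> M) :=
  GRing.isZmodMorphism.Build group_ring M (gring_lift f) (gring_lift_is_additive f).

Definition gring_lmul (x : G) : group_ring -> group_ring :=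
  gring_lift (fun y => gring_of (x * y)%g).

(* The image in Z[G] of the Fox derivative of w with respect to the j-th
   generator, by d(aw) = da + a dw and d(g^-1) = - g^-1 dg. *)
Definition fox_letter k (g : 'I_k -> G) (j : 'I_k) (a : 'I_k * bool) : group_ring :=
  if a.1 == j then if a.2 then - gring_of (g j)^-1%g else gring_of 1%g else 0.

Fixpoint fox k (g : 'I_k -> G) (j : 'I_k) (w : word k) : group_ring :=
  if w is a :: w' then fox_letter g j a + gring_lmul (eval_letter g a) (fox g j w')
  else 0.

End GroupRing.

Section Representations.
Variables (R : realType) (G : groupType).
Local Notation C := (R[i]).

Definition is_SL2_representation (rho : G -> 'M[C]_2) : Prop :=
  (forall x y, rho (x * y)%g = rho x *m rho y) /\ (forall x, \det (rho x) = 1).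

Definition irreducible_representation (rho : G -> 'M[C]_2) : Prop :=
  forall v : 'cV[C]_2, v != 0 -> ~ (forall x, exists c : C, rho x *m v = c *: v).

Definition metabelian_representation (rho : G -> 'M[C]_2) : Prop :=
  forall x y, commutator_subgroup x -> commutator_subgroup y ->
    rho x *m rho y = rho y *m rho x.

(* C(t), in which C[t, t^-1] embeds. *)
Definition rational_functions : fieldType := {fraction {poly C}}.
Local Notation F := rational_functions.

Definition tvar : F := tofrac 'X.

Definition const_frac (c : C) : F := tofrac c%:P.

Variables (alpha : G -> int) (rho : G -> 'M[C]_2).

Definition Phi : {freeg G / int} -> 'M[F]_2 :=
  gring_lift (fun x => tvar ^ alpha x *: map_mx const_frac (rho x)).

Definition fox_matrix n (g : 'I_n.+1 -> G) (r : 'I_n -> word n.+1)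
    (l : 'I_n.+1) : 'M[F]_(\sum_(i < n) 2) :=
  \mxblock_(i < n, j < n) Phi (fox g (fintype.lift l j) (r i)).

Definition twisted_alexander n (g : 'I_n.+1 -> G) (r : 'I_n -> word n.+1)
    (l : 'I_n.+1) : F :=
  \det (fox_matrix g r l) / \det (Phi (gring_of (g l) - gring_of 1%g)).

End Representations.

Section LaurentPolynomials.
Variable R : realType.

Definition laurent_polynomial (p : {poly R[i]}) (n : nat) : rational_functions R :=
  \sum_(i < size p) const_frac p`_i * tvar R ^ (i%:Z - n%:Z).

(* f is a Laurent polynomial all of whose terms have even degree. *)
Definition is_even_laurent_polynomial (f : rational_functions R) : Prop :=
  exists (p : {poly R[i]}) (n : nat), f = laurent_polynomial p n /\
    (forall i : nat, p`_i != 0 -> (2 %| i%:Z - n%:Z)%Z).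

End LaurentPolynomials.

(* Main.v *)
Require Import Defs.
From HB Require Import structures.
From mathcomp Require Import all_boot all_order all_algebra.
From mathcomp Require Import all_classical all_reals all_analysis.
From mathcomp Require Import complex spectral.
From mathcomp.multinomials Require Import freeg.

(** Write G for the group, t for the variable, and sigma for the twisted
representation x |-> t^(alpha x) rho(x) over the field C(t).

Why rho is monomial. The commutator subgroup is the kernel of alpha, and its
image under rho is commutative. If it consisted of scalars, an eigenvector of
rho(m), for m with alpha(m) = 1, would be a common eigenvector of G. So some
c in the kernel has rho(c) nonscalar; its eigenspaces are lines, which the
whole kernel preserves. If v spans one of them, the kernel preserves the line
of w = rho(m) v too, because it is normal. Irreducibility makes v and w
independent and forces rho(m) w into the line of v. In the basis (v, w) the
kernel is thus diagonal and rho(m) is antidiagonal ([monomial_form]), and rho(c)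
is diag(mu, nu) with mu nu = 1 and mu <> nu, so that neither of them is 1.

Why only even powers occur. In the basis (v, t w) of C(t)^2, sigma(m) has the
rows (0, b t^2) and (1, 0), for a nonzero complex number b, and the kernel of
alpha acts by constant diagonal matrices. So all matrices of sigma have entries
in the ring E of even Laurent polynomials ([twist_even_form]). Neither
determinant in the definition of the invariant changes with the basis.

Why the quotient is a Laurent polynomial. Choose a word that represents the
element c above. By the fundamental formula of the Fox calculus, adding the row
of the derivatives of this word to the Fox matrix gives a square matrix M such
that
  det (Fox matrix without column l) * det (sigma(c) - 1)
    = det M * det (sigma(g_l) - 1)
([fox_det_exchange]). Hence the invariant is det M / det (sigma(c) - 1). Here
det M is in E, and det (sigma(c) - 1) = (mu - 1)(nu - 1) is a nonzero complex
number since alpha(c) = 0 ([fox_quotient_over]). *)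

Set Implicit Arguments.
Unset Strict Implicit.
Unset Printing Implicit Defensive.

Import Order.TTheory GRing.Theory Num.Theory.
Local Open Scope ring_scope.

(** * Representations of the group ring and Fox matrices *)

Section GroupRingRepresentation.
Variables (G : groupType) (A : comNzRingType) (d : nat) (sigma : G -> 'M[A]_d).
Local Notation group_ring := {freeg G / int}.
Hypothesis sigma1 : sigma 1%g = 1%:M.
Hypothesis sigmaM : forall x y, sigma (x * y)%g = sigma x *m sigma y.

Lemma gring_lift_lmul x (c : group_ring) :
  gring_lift sigma (gring_lmul x c) = sigma x *m gring_lift sigma c.
Proof.
rewrite /gring_lmul [X in gring_lift sigma X = _]/gring_lift raddf_sum.
rewrite [in RHS]/gring_lift mulmx_sumr; apply: eq_bigr => y _.
by rewrite raddfMz /= gring_lift_of sigmaM -!scaler_int scalemxAr.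
Qed.

Lemma gring_lift_conj (P Q : 'M[A]_d) (c : group_ring) :
  gring_lift (fun x => P *m sigma x *m Q) c = P *m gring_lift sigma c *m Q.
Proof.
rewrite /gring_lift mulmx_sumr mulmx_suml; apply: eq_bigr => y _.
by rewrite -!scaler_int -scalemxAr -scalemxAl.
Qed.

Section Fox.
Variables (k : nat) (g : 'I_k -> G).

(** The fundamental formula of the Fox calculus, pushed forward to matrices. *)
Lemma fox_fundamental (w : word k) :
  \sum_j gring_lift sigma (fox g j w) *m (sigma (g j) - 1%:M)
    = sigma (eval_word g w) - 1%:M.
Proof.
elim: w => [|[i b] w IHw] /=.
  by rewrite sigma1 subrr big1 // => j _; rewrite raddf0 mul0mx.
under eq_bigr => j _ do
  rewrite [gring_lift _ _]raddfD /= gring_lift_lmul mulmxDl -mulmxA.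
rewrite big_split /= -mulmx_sumr IHw sigmaM mulmxBr mulmx1.
rewrite addrC -addrA; congr (_ + _).
rewrite (bigD1 i) //= big1 => [|j /negPf ji]; last first.
  by rewrite /fox_letter /= eq_sym ji raddf0 mul0mx.
rewrite /fox_letter /eval_letter /= eqxx addr0; case: b => /=.
  by rewrite raddfN /= gring_lift_of mulNmx mulmxBr -sigmaM mulVg sigma1 mulmx1
    opprB addKr.
by rewrite gring_lift_of sigma1 mul1mx addKr.
Qed.

End Fox.
End GroupRingRepresentation.

Section FoxMatrices.
Variables (G : groupType) (A : comNzRingType) (d n : nat).
Variables (g : 'I_n.+1 -> G) (r : 'I_n -> word n.+1) (l : 'I_n.+1).

Definition fox_block (T : {freeg G / int} -> 'M[A]_d) :=
  \mxblock_(i < n, j < n) T (fox g (fintype.lift l j) (r i)).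

(** The Fox matrix of the relators and of one more word w, with the column of
the l-th generator moved to the end. *)
Definition fox_extended (T : {freeg G / int} -> 'M[A]_d) (w : word n.+1) :=
  block_mx (fox_block T) (\mxcol_(i < n) T (fox g l (r i)))
    (\mxrow_(j < n) T (fox g (fintype.lift l j) w)) (T (fox g l w)).

(** Multiplying [fox_extended] on the right by the matrix that replaces its last
column by the combination of columns in the fundamental formula makes it block
lower triangular: the relators contribute zeros, and w contributes
sigma(w) - 1. *)
Lemma fox_det_exchange (sigma : G -> 'M[A]_d) w :
  sigma 1%g = 1%:M -> (forall x y, sigma (x * y)%g = sigma x *m sigma y) ->
  (forall i, eval_word g (r i) = 1%g) ->
  \det (fox_block (gring_lift sigma)) * \det (sigma (eval_word g w) - 1%:M) =
  \det (fox_extended (gring_lift sigma) w) * \det (sigma (g l) - 1%:M).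
Proof.
move=> sigma1 sigmaM r1; set L := gring_lift sigma.
pose N := block_mx 1%:M (\mxcol_(j < n) (sigma (g (fintype.lift l j)) - 1%:M))
  0 (sigma (g l) - 1%:M).
(* The fundamental formula, with the l-th term last. *)
have fund u : \sum_(j < n) L (fox g (fintype.lift l j) u) *m
      (sigma (g (fintype.lift l j)) - 1%:M) + L (fox g l u) *m (sigma (g l) - 1%:M)
    = sigma (eval_word g u) - 1%:M.
  by rewrite -(fox_fundamental sigma1 sigmaM) (bigD1_ord l) //= addrC.
have <- : \det N = \det (sigma (g l) - 1%:M) by rewrite det_ublock det1 mul1r.
rewrite -det_mulmx /fox_extended mulmx_block !mulmx1 !mulmx0 !addr0.
rewrite mul_mxblock_mxrow mul_mxrow_mxcol mxcol_mul -mxcolD.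
under eq_mxcol => i do rewrite fund r1 sigma1 subrr.
by rewrite fund mxcol0 det_lblock.
Qed.

Lemma fox_block_conj (T S : {freeg G / int} -> 'M[A]_d) (P Q : 'M[A]_d) :
  P *m Q = 1%:M -> (forall c, S c = P *m T c *m Q) ->
  \det (fox_block S) = \det (fox_block T).
Proof.
move=> PQ ST.
have -> : fox_block S = \mxdiag_(i < n) P *m fox_block T *m \mxdiag_(i < n) Q.
  rewrite mul_mxdiag_mxblock mul_mxblock_mxdiag.
  by apply: eq_mxblock => i j; exact: ST.
have PQ1 : \mxdiag_(i < n) P *m \mxdiag_(i < n) Q = 1%:M.
  rewrite -mxdiagZ [X in _ *m X]/mxdiag mul_mxdiag_mxblock; apply: eq_mxblock => i j.
  by case: ifP => _; rewrite ?conform_mx_id ?mulmx0.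
by rewrite !det_mulmx mulrAC -det_mulmx PQ1 det1 mul1r.
Qed.

End FoxMatrices.

(** * Linear algebra in the plane *)

Section Planar.
Variable F : fieldType.

Definition mx2 (a b c d : F) : 'M[F]_2 :=
  block_mx a%:M b%:M c%:M d%:M : 'M[F]_(1 + 1).

Definition basis2 (v w : 'cV[F]_2) : 'M[F]_2 := row_mx v w : 'M[F]_(2, 1 + 1).

Lemma mx2M a b c d a' b' c' d' : mx2 a b c d *m mx2 a' b' c' d' =
  mx2 (a * a' + b * c') (a * b' + b * d') (c * a' + d * c') (c * b' + d * d').
Proof. by rewrite /mx2 (@mulmx_block _ 1 1 1 1 1 1) -!scalar_mxM -!raddfD. Qed.

Lemma mx2_scalar a : mx2 a 0 0 a = a%:M.
Proof. by rewrite /mx2 raddf0 [RHS](@scalar_mx_block _ 1 1). Qed.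

Lemma det_mx2_diag a b : \det (mx2 a 0 0 b) = a * b.
Proof. by rewrite /mx2 raddf0 (@det_ublock _ 1 1) !det_scalar1. Qed.

Lemma basis2_mx2 v w a b c d :
  basis2 v w *m mx2 a b c d = basis2 (a *: v + c *: w) (b *: v + d *: w).
Proof.
by rewrite /basis2 /mx2 (@mul_row_block _ _ 1 1 1 1) !mul_mx_scalar.
Qed.

Lemma mul_basis2 (A : 'M[F]_2) v w : A *m basis2 v w = basis2 (A *m v) (A *m w).
Proof. exact: (@mul_mx_row _ _ _ 1 1). Qed.

Lemma basis2_unit (v w : 'cV[F]_2) : v != 0 -> ~ (exists a, w = a *: v) ->
  basis2 v w \in unitmx.
Proof.
move=> v0 wv; rewrite -unitmx_tr unitmxE unitfE; apply/det0P => -[x x0].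
rewrite /basis2 (@tr_row_mx _ _ 1 1) -[x](@hsubmxK _ _ 1 1) (@mul_row_col _ _ 1 1).
move=> /(congr1 trmx); rewrite linearD /= !trmx_mul !trmxK linear0.
set a := (@lsubmx _ 1 1 1 x)^T; set b := (@rsubmx _ 1 1 1 x)^T.
rewrite [a]mx11_scalar [b]mx11_scalar !mul_mx_scalar => e.
have [b0|b0] := eqVneq (b 0 0) 0.
  move: e; rewrite b0 scale0r addr0 => /eqP.
  rewrite scaler_eq0 (negPf v0) orbF => /eqP a0.
  move/negP: x0; apply; apply/eqP; rewrite -[x](@hsubmxK _ _ 1 1).
  rewrite -[@lsubmx _ 1 1 1 x]trmxK -[@rsubmx _ 1 1 1 x]trmxK -/a -/b
    [a]mx11_scalar [b]mx11_scalar.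
  by rewrite a0 b0 raddf0 trmx0 (@row_mx0 _ _ 1 1).
apply: wv; exists (- (b 0 0)^-1 * a 0 0); apply: (scalerI b0).
rewrite !scalerA mulrA mulrN mulfV // mulN1r scaleNr.
by apply/eqP; rewrite eq_sym eqr_oppLR -addr_eq0 e.
Qed.

Lemma basis2_coord (v w u : 'cV[F]_2) : basis2 v w \in unitmx ->
  exists a b, u = a *: v + b *: w.
Proof.
move=> U; rewrite -[u](mulKVmx U); set x := invmx _ *m u.
exists (@usubmx _ 1 1 1 x 0 0), (@dsubmx _ 1 1 1 x 0 0).
rewrite -[in LHS](@vsubmxK _ 1 1 1 x) /basis2 (@mul_row_col _ _ 1 1 1).
by rewrite -!mul_mx_scalar -!mx11_scalar.
Qed.

(** An eigenspace that contains two independent vectors of the plane is the whole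
plane. *)
Lemma nonscalar_eigenspace (A : 'M[F]_2) mu (v u : 'cV[F]_2) :
  A <> mu%:M -> v != 0 -> A *m v = mu *: v -> A *m u = mu *: u ->
  exists a, u = a *: v.
Proof.
move=> Ans v0 Av Au; apply: contrapT => uv; apply: Ans.
have U := basis2_unit v0 uv.
apply: (can_inj (mulmxK U)).
by rewrite !mul_basis2 Av Au !mul_scalar_mx.
Qed.

Lemma mx2_diagC a d t :
  mx2 a 0 0 d *m mx2 1 0 0 t = mx2 1 0 0 t *m mx2 a 0 0 d.
Proof. by rewrite !mx2M !(mul0r, mulr0, addr0, add0r, mul1r, mulr1) mulrC. Qed.

Lemma mx2_antidiag_rescale b t :
  t *: (mx2 0 b 1 0 *m mx2 1 0 0 t) = mx2 1 0 0 t *m mx2 0 (b * t ^+ 2) 1 0.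
Proof.
rewrite -mul_scalar_mx -mx2_scalar !mx2M.
by rewrite !(mul0r, mulr0, addr0, add0r, mul1r, mulr1) mulrCA.
Qed.

Lemma mx2_antidiagV b : b != 0 -> mx2 0 b 1 0 *m mx2 0 1 b^-1 0 = 1%:M.
Proof.
move=> b0; rewrite mx2M -mx2_scalar !(mul0r, mulr0, addr0, add0r, mul1r).
by rewrite mulfV.
Qed.

Lemma mx2_diag_sub1 a d : mx2 a 0 0 d - 1%:M = mx2 (a - 1) 0 0 (d - 1).
Proof.
rewrite -mx2_scalar /mx2 (@opp_block_mx _ 1 1 1 1) (@add_block_mx _ 1 1 1 1).
by rewrite -!raddfB subrr.
Qed.

End Planar.

Section PlanarMap.
Variables (F K : fieldType) (f : {rmorphism F -> K}).

Lemma map_mx2 a b c d : map_mx f (mx2 a b c d) = mx2 (f a) (f b) (f c) (f d).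
Proof. by rewrite /mx2 (@map_block_mx _ _ _ 1 1 1 1) !map_scalar_mx. Qed.

Lemma map_mx2_diag a d : map_mx f (mx2 a 0 0 d) = mx2 (f a) 0 0 (f d).
Proof. by rewrite map_mx2 rmorph0. Qed.

Lemma map_mx2_antidiag b : map_mx f (mx2 0 b 1 0) = mx2 0 (f b) 1 0.
Proof. by rewrite map_mx2 rmorph0 rmorph1. Qed.

End PlanarMap.

Lemma complex_eigenvector (C : numClosedFieldType) n (A : 'M[C]_n.+1) :
  exists (v : 'cV[C]_n.+1) mu, v != 0 /\ A *m v = mu *: v.
Proof.
have [mu /eigenvalueP[v vA v0]] := eigenvalue_closed A^T (ltn0Sn n).
exists v^T, mu; split; first by rewrite trmx_eq0.
by rewrite -[A]trmxK -trmx_mul vA linearZ.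
Qed.

Section Conjugation.
Variables (F : fieldType) (d : nat) (Q : 'M[F]_d).
Hypothesis Qu : Q \in unitmx.

Lemma invmx_conjM X Y :
  invmx Q *m (X *m Y) *m Q = (invmx Q *m X *m Q) *m (invmx Q *m Y *m Q).
Proof. by rewrite -!mulmxA (mulKVmx Qu). Qed.

Lemma invmx_conj1 : invmx Q *m 1%:M *m Q = 1%:M.
Proof. by rewrite mulmx1 mulVmx. Qed.

Lemma det_invmx_conj_sub1 X : \det (invmx Q *m X *m Q - 1%:M) = \det (X - 1%:M).
Proof.
rewrite -[in LHS]invmx_conj1 -mulmxBl -mulmxBr !det_mulmx mulrAC -det_mulmx.
by rewrite mulVmx // det1 mul1r.
Qed.

End Conjugation.

(** * Matrices over a subring *)

Lemma mxOver_mx2 (F : fieldType) (E : subringClosed F) a b c d :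
  a \in E -> b \in E -> c \in E -> d \in E -> mx2 a b c d \is a mxOver E.
Proof.
move=> aE bE cE dE.
have E1 x : x \in E -> (x%:M : 'M[F]_1) \is a mxOver E.
  by move=> xE; apply/mxOverP => i j; rewrite !mxE rpredMn.
apply/mxOverP => i j; rewrite /mx2 !mxE.
by case: splitP => i' _; rewrite !mxE; case: splitP => j' _; apply/mxOverP/E1.
Qed.

Lemma mxOver_det (A : comNzRingType) (E : subringClosed A) d (M : 'M[A]_d) :
  M \is a mxOver E -> \det M \in E.
Proof.
move=> /mxOverP ME; apply: rpred_sum => s _.
by rewrite rpredM ?rpredX ?rpredN ?rpred1 ?rpred_prod.
Qed.

Section FoxOver.
Variables (G : groupType) (A : comNzRingType) (d n : nat) (E : subringClosed A).
Variables (g : 'I_n.+1 -> G) (r : 'I_n -> word n.+1) (l : 'I_n.+1).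

Lemma gring_lift_over (sigma : G -> 'M[A]_d) c :
  (forall x, sigma x \is a mxOver E) -> gring_lift sigma c \is a mxOver E.
Proof. by move=> sE; apply: rpred_sum => x _; rewrite rpredMz. Qed.

Lemma fox_extended_over (sigma : G -> 'M[A]_d) w :
  (forall x, sigma x \is a mxOver E) ->
  fox_extended g r l (gring_lift sigma) w \is a mxOver E.
Proof.
move=> sE; have LE c := mxOverP (gring_lift_over c sE).
apply/mxOverP => i j; rewrite /fox_extended /fox_block !mxE.
by case: splitP => i' _; rewrite !mxE; case: splitP => j' _; rewrite ?mxE.
Qed.
End FoxOver.

(** * Even Laurent polynomials *)

Section EvenLaurent.
Variable R : realType.
Local Notation C := R[i].
Local Notation F := (rational_functions R).

HB.instance Definition _ := GRing.RMorphism.copy (@const_frac R)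
  ((@tofrac {poly C} : {poly C} -> F) \o polyC).

Lemma tvar_neq0 : tvar R != 0.
Proof. by rewrite tofrac_eq0 polyX_eq0. Qed.

(** C[t^2, t^-2] as a subset of C(t). Writing the numerator as a polynomial in
the square of the variable makes closure under the ring operations a
consequence of the fact that composition is a ring morphism. *)
Definition even_laurent : {pred F} := fun f =>
  `[< exists (q : {poly C}) (k : nat), f = tofrac (q \Po 'X^2) / tvar R ^+ (2 * k) >].

Lemma even_laurentP f : f \in even_laurent <->
  exists (q : {poly C}) (k : nat), f = tofrac (q \Po 'X^2) / tvar R ^+ (2 * k).
Proof. by split=> [/asboolP|?]; last exact/asboolP. Qed.

Lemma even_laurent_subring : subring_closed even_laurent.
Proof.
have t0 k : tvar R ^+ k != 0 by rewrite expf_neq0 // tvar_neq0.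
have shift (q : {poly C}) k : tofrac (q \Po 'X^2) * tvar R ^+ (2 * k) =
    tofrac ((q * 'X^k) \Po 'X^2).
  by rewrite comp_polyM comp_Xn_poly -exprM rmorphM /= rmorphXn.
split=> [|f h /even_laurentP[q [k ->]] /even_laurentP[q' [k' ->]]|
          f h /even_laurentP[q [k ->]] /even_laurentP[q' [k' ->]]];
  apply/even_laurentP.
- by exists 1, 0; rewrite comp_polyC rmorph1 muln0 divr1.
- exists (q * 'X^k' - q' * 'X^k), (k + k')%N.
  rewrite comp_polyB rmorphB /= -!shift mulnDr exprD.
  by rewrite -[in LHS]mulNr addf_div ?mulNr.
exists (q * q'), (k + k')%N.
by rewrite comp_polyM rmorphM mulnDr exprD mulf_div.
Qed.

HB.instance Definition _ := GRing.isSubringClosed.Build F even_laurent even_laurent_subring.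

Lemma const_even c : const_frac c \in even_laurent.
Proof. by apply/even_laurentP; exists c%:P, 0%N; rewrite comp_polyC muln0 divr1. Qed.

Lemma tvar2_even : tvar R ^+ 2 \in even_laurent.
Proof. by apply/even_laurentP; exists 'X, 0%N; rewrite comp_polyX muln0 divr1 rmorphXn. Qed.

Lemma tvar2V_even : tvar R ^- 2 \in even_laurent.
Proof. by apply/even_laurentP; exists 1, 1%N; rewrite comp_polyC rmorph1 div1r. Qed.

Lemma even_laurent_is_even f : f \in even_laurent -> is_even_laurent_polynomial f.
Proof.
move=> /even_laurentP[q [k ->]].
exists (q \Po 'X^2), (2 * k)%N; split=> [|i]; last first.
  rewrite coef_comp_poly_Xn //; case: ifP => [i2 _|_]; last by rewrite eqxx.
  by rewrite rpredB // PoszM dvdz_mulr.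
rewrite /laurent_polynomial -[in LHS](coefK (q \Po 'X^2)) poly_def rmorph_sum.
rewrite mulr_suml; apply: eq_bigr => i _.
rewrite -mul_polyC rmorphM rmorphXn /= -mulrA; congr (_ * _).
by rewrite expfzDr ?tvar_neq0 // exprnN.
Qed.
End EvenLaurent.

(** * Homomorphisms onto the integers *)

Section IntegerCharacter.
Variables (G : groupType) (alpha : G -> int).
Hypothesis alphaM : forall x y, alpha (x * y)%g = alpha x + alpha y.

Lemma character1 : alpha 1%g = 0.
Proof. by apply: (addrI (alpha 1%g)); rewrite -alphaM mulg1 addr0. Qed.

Lemma characterV x : alpha x^-1%g = - alpha x.
Proof. by apply/eqP; rewrite -addr_eq0 -alphaM mulVg character1. Qed.

(** A surjection onto the integers splits: G is generated by its kernel and by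
any m of degree 1. *)
Lemma character_ind (m : G) (P : G -> Prop) :
  alpha m = 1 -> P m -> P m^-1%g -> (forall x, alpha x = 0 -> P x) ->
  (forall x y, P x -> P y -> P (x * y)%g) -> forall x, P x.
Proof.
move=> m1 Pm PmV Pker PM x.
have [k] : exists k : nat, alpha x = k%:Z \/ alpha x = - k%:Z.
  by case: (alpha x) => k; [exists k; left | exists k.+1; right; rewrite NegzE].
elim: k x => [|k IHk] x; first by case=> x0; apply: Pker; rewrite x0 ?oppr0.
case=> xk.
  rewrite -(mulVKg m x); apply: PM => //; apply: IHk; left.
  by rewrite alphaM characterV m1 xk -addn1 PoszD addrC addrK.
rewrite -(mulKg m x); apply: PM => //; apply: IHk; right.
by rewrite alphaM m1 xk -addn1 PoszD opprD addrCA subrr addr0.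
Qed.

End IntegerCharacter.

(** * Irreducible metabelian representations are monomial *)

Section MonomialForm.
Variables (R : realType) (G : groupType) (alpha : G -> int).
Local Notation C := R[i].
Variable rho : G -> 'M[C]_2.
Hypothesis rep_rho : is_SL2_representation rho.

Let rhoM x y : rho (x * y)%g = rho x *m rho y. Proof. by case: rep_rho. Qed.

Lemma SL2_unit x : rho x \in unitmx.
Proof. by rewrite unitmxE (proj2 rep_rho) unitr1. Qed.

Lemma SL2_rep1 : rho 1%g = 1%:M.
Proof. by apply: (can_inj (mulKmx (SL2_unit 1%g))); rewrite -rhoM mulg1 mulmx1. Qed.

Lemma SL2_repK x v : rho x^-1%g *m (rho x *m v) = v :> 'cV_2.
Proof. by rewrite mulmxA -rhoM mulVg SL2_rep1 mul1mx. Qed.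

Hypothesis ab_alpha : is_abelianization alpha.
Hypothesis irr_rho : irreducible_representation rho.
Hypothesis metab_rho : metabelian_representation rho.

Let alphaM x y : alpha (x * y)%g = alpha x + alpha y. Proof. by case: ab_alpha. Qed.

(** Together with the kernel of alpha, m generates G, so a line preserved by both
would contradict irreducibility. *)
Lemma no_common_eigenvector m (v : 'cV_2) :
  alpha m = 1 -> v != 0 -> (forall x, alpha x = 0 -> exists a, rho x *m v = a *: v) ->
  ~ (exists a, rho m *m v = a *: v).
Proof.
move=> m1 v0 kerv [a mv]; apply: (irr_rho v0).
have a0 : a != 0.
  by apply: contraNneq v0 => a0; rewrite -(SL2_repK m v) mv a0 scale0r mulmx0.
apply: (character_ind alphaM m1) => //; first by exists a.
  exists a^-1; rewrite -[in LHS](scalerK a0 v) -mv -scalemxAr.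
  by rewrite SL2_repK.
move=> x y [b bE] [c cE]; exists (c * b).
by rewrite rhoM -mulmxA cE -scalemxAr bE scalerA.
Qed.

(** If the kernel of alpha acted by scalars, every eigenvector of rho(m) would be
an eigenvector of all of G. *)
Lemma kernel_nonscalar m : alpha m = 1 ->
  exists2 c, alpha c = 0 & forall a, rho c <> a%:M.
Proof.
move=> m1; apply: contrapT => H.
have [v [mu [v0 vE]]] := complex_eigenvector (rho m).
apply: (no_common_eigenvector m1 v0); last by exists mu.
move=> x x0; apply: contrapT => Hx; apply: H; exists x => // a xa.
by apply: Hx; exists a; rewrite xa mul_scalar_mx.
Qed.

(** The matrices of rho in the basis (v, rho(m) v), where v is an eigenvector of a
nonscalar rho(c) with alpha(c) = 0. *)
Lemma monomial_form : exists m P b,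
  [/\ alpha m = 1, P \in unitmx, b != 0, rho m *m P = P *m mx2 0 b 1 0 &
   (forall x, alpha x = 0 -> exists mu nu, rho x *m P = P *m mx2 mu 0 0 nu) /\
   exists c mu nu, [/\ alpha c = 0, rho c *m P = P *m mx2 mu 0 0 nu,
     mu != 1 & nu != 1]].
Proof.
have [_ /(_ 1)[m m1] ker_alpha] := ab_alpha.
have [c c0 cns] := kernel_nonscalar m1.
have [v [mu [v0 cv]]] := complex_eigenvector (rho c).
pose w := rho m *m v.
have kerv x : alpha x = 0 -> exists a, rho x *m v = a *: v.
  move=> x0; apply: (nonscalar_eigenspace (cns mu) v0 cv).
  rewrite mulmxA metab_rho; [|exact/ker_alpha|exact/ker_alpha].
  by rewrite -mulmxA cv -scalemxAr.
(* The kernel is normal: moving x across m replaces it by m^-1 x m. *)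
have conj_m x : alpha x = 0 -> exists2 y, alpha y = 0 &
    forall u : 'cV_2, rho x *m (rho m *m u) = rho m *m (rho y *m u).
  move=> x0; exists (m^-1 * (x * m))%g => [|u].
    by rewrite !alphaM (characterV alphaM) x0 add0r addNr.
  by rewrite !mulmxA -!rhoM mulVKg.
have kerw x : alpha x = 0 -> exists a, rho x *m w = a *: w.
  move=> /conj_m[y /kerv[a yv] xm]; exists a.
  by rewrite /w xm yv -scalemxAr.
have wv : ~ exists a, w = a *: v := no_common_eigenvector m1 v0 kerv.
have w0 : w != 0.
  by apply: contra_notN wv => /eqP ->; exists 0; rewrite scale0r.
have U := basis2_unit v0 wv.
have [nu cw] := kerw c c0.
have diag x a b : rho x *m v = a *: v -> rho x *m w = b *: w ->
    rho x *m basis2 v w = basis2 v w *m mx2 a 0 0 b.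
  by move=> xv xw; rewrite mul_basis2 basis2_mx2 xv xw !scale0r addr0 add0r.
have munu : mu <> nu.
  move=> e; apply: (cns mu); apply: (can_inj (mulmxK U)).
  by rewrite (diag _ _ _ cv cw) -e mx2_scalar scalar_mxC.
have munu1 : mu * nu = 1.
  have /(congr1 determinant) := diag _ _ _ cv cw.
  rewrite !det_mulmx (proj2 rep_rho) det_mx2_diag mul1r -[LHS]mulr1.
  by move/mulrI => -> //; rewrite -unitmxE.
pose u := rho m *m w.
have uw : ~ exists a, u = a *: w := no_common_eigenvector m1 w0 kerw.
have [e ue] : exists e, rho c *m u = e *: u.
  have [y /kerw[e yw] xm] := conj_m c c0; exists e.
  by rewrite /u xm yw -scalemxAr.
(* If u were not an eigenvector of rho(c) for mu, applying rho(c) - mu to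
   u = a v + b w would kill a v and show that u is a multiple of w. *)
have [b uE] : exists b, u = b *: v.
  have [a [b uE]] := basis2_coord u U.
  have [emu|emu] := eqVneq e mu.
    by apply: (nonscalar_eigenspace (cns mu) v0 cv); rewrite -emu.
  case: uw; exists ((e - mu)^-1 * (b * (nu - mu))).
  have ne : e - mu != 0 by rewrite subr_eq0.
  apply: (scalerI ne); rewrite !scalerA mulrA mulfV // mul1r scalerBl -ue uE.
  rewrite mulmxDr -!scalemxAr cv cw !scalerDr !scalerA !(mulrC mu) opprD.
  by rewrite addrACA subrr add0r mulrBr scalerBl.
have b0 : b != 0.
  by apply: contra_notN uw => /eqP b0; exists 0; rewrite uE b0 !scale0r.
exists m, (basis2 v w), b; split=> //.
  by rewrite mul_basis2 -/u basis2_mx2 uE scale1r !scale0r addr0 add0r.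
split=> [x x0|].
  by have [[a xv] [d xw]] := (kerv x x0, kerw x x0); exists a, d; exact: diag.
exists c, mu, nu; split=> //; first exact: diag.
- by apply: contra_notN munu => /eqP mu1; move: munu1; rewrite mu1 mul1r.
- by apply: contra_notN munu => /eqP nu1; move: munu1; rewrite nu1 mulr1.
Qed.

End MonomialForm.

(** * The Fox quotient of a representation *)

Section FoxQuotient.
Variables (G : groupType) (K : fieldType) (E : subringClosed K) (d n : nat).
Variables (g : 'I_n.+1 -> G) (r : 'I_n -> word n.+1) (l : 'I_n.+1).
Variable sigma : G -> 'M[K]_d.
Hypothesis sigma1 : sigma 1%g = 1%:M.
Hypothesis sigmaM : forall x y, sigma (x * y)%g = sigma x *m sigma y.
Local Notation L := (gring_lift sigma).

(** By [fox_det_exchange] the quotient can be computed with det (sigma(c) - 1) as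
its denominator, for any c; and it is the same for the conjugate
representation, whose Fox derivatives have their entries in E. *)
Lemma fox_quotient_over (Q : 'M[K]_d) (c : G) :
  is_presentation g r -> Q \in unitmx ->
  (forall x, invmx Q *m sigma x *m Q \is a mxOver E) ->
  \det (sigma c - 1%:M) != 0 -> (\det (sigma c - 1%:M))^-1 \in E ->
  \det (fox_block g r l L) / \det (L (gring_of (g l) - gring_of 1%g)) \in E.
Proof.
move=> [gen rel] Qu SE c0 cE.
have r1 i : eval_word g (r i) = 1%g by apply/rel; exact: normal_closure_relator.
have [w wc] := gen c.
pose S x := invmx Q *m sigma x *m Q.
have S1 : S 1%g = 1%:M by rewrite /S sigma1 invmx_conj1.
have SM x y : S (x * y)%g = S x *m S y by rewrite /S sigmaM invmx_conjM.
have detS x : \det (S x - 1%:M) = \det (sigma x - 1%:M).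
  exact: det_invmx_conj_sub1.
rewrite [L _]raddfB /= !gring_lift_of sigma1 -detS.
rewrite -(fox_block_conj g r l (mulVmx Qu) (gring_lift_conj sigma (invmx Q) Q)).
(* The inverse of 0 is 0 by convention, so a zero denominator gives the value 0. *)
have [->|den0] := eqVneq (\det (S (g l) - 1%:M)) 0.
  by rewrite invr0 mulr0 rpred0.
have exch := fox_det_exchange l w S1 SM r1; rewrite wc detS in exch.
rewrite -[X in X / _](mulfK c0) exch mulrAC mulfK // rpredM //.
exact/mxOver_det/fox_extended_over.
Qed.

End FoxQuotient.

(** * The twisted representation over the even Laurent polynomials *)

Section Twist.
Variables (R : realType) (G : groupType) (alpha : G -> int).
Local Notation C := R[i].
Variable rho : G -> 'M[C]_2.
Variables (K : fieldType) (f : {rmorphism C -> K}) (t : K).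
Hypothesis t0 : t != 0.

Definition twist (x : G) : 'M[K]_2 := t ^ alpha x *: map_mx f (rho x).

Hypothesis rep_rho : is_SL2_representation rho.
Hypothesis ab_alpha : is_abelianization alpha.

Let alphaM x y : alpha (x * y)%g = alpha x + alpha y. Proof. by case: ab_alpha. Qed.

Lemma twistM x y : twist (x * y)%g = twist x *m twist y.
Proof.
rewrite /twist alphaM (proj1 rep_rho) map_mxM expfzDr //.
by rewrite -scalemxAl -scalemxAr scalerA.
Qed.

Lemma twist1 : twist 1%g = 1%:M.
Proof.
by rewrite /twist (character1 alphaM) (SL2_rep1 rep_rho) map_mx1 scale1r.
Qed.

Hypothesis irr_rho : irreducible_representation rho.
Hypothesis metab_rho : metabelian_representation rho.
Variable E : subringClosed K.
Hypothesis constE : forall a, f a \in E.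
Hypothesis t2E : t ^+ 2 \in E.
Hypothesis t2VE : t ^- 2 \in E.

(** The change of basis is the one that makes rho monomial followed by
diag(1, t): it turns the entries t b and t of the twisted antidiagonal matrix
into t^2 b and 1. *)
Lemma twist_even_form : exists2 Q : 'M[K]_2, Q \in unitmx &
  (forall x, invmx Q *m twist x *m Q \is a mxOver E) /\
  exists c, \det (twist c - 1%:M) != 0 /\ (\det (twist c - 1%:M))^-1 \in E.
Proof.
have [m [P [b [m1 Pu b0 mP [kerP [c [mu [nu [c0 cP mu1 nu1]]]]]]]]] :=
  monomial_form rep_rho ab_alpha irr_rho metab_rho.
pose D := mx2 1 0 0 t.
have Du : D \in unitmx by rewrite unitmxE det_mx2_diag mul1r unitfE.
pose Q := map_mx f P *m D.
have Qu : Q \in unitmx by rewrite unitmx_mul Du map_unitmx Pu.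
have twistE x S S' : rho x *m P = P *m S ->
    t ^ alpha x *: (map_mx f S *m D) = D *m S' -> invmx Q *m twist x *m Q = S'.
  move=> xP SS'; rewrite -mulmxA -[RHS](mulKmx Qu); congr (_ *m _).
  rewrite /Q /twist -scalemxAl !mulmxA -map_mxM xP map_mxM -mulmxA scalemxAr.
  by rewrite SS' mulmxA.
have kerE x a d : alpha x = 0 -> rho x *m P = P *m mx2 a 0 0 d ->
    invmx Q *m twist x *m Q = mx2 (f a) 0 0 (f d).
  move=> x0 xP; apply: (twistE _ _ _ xP).
  by rewrite x0 scale1r map_mx2_diag mx2_diagC.
have mE : invmx Q *m twist m *m Q = mx2 0 (f b * t ^+ 2) 1 0.
  by apply: (twistE _ _ _ mP); rewrite m1 map_mx2_antidiag mx2_antidiag_rescale.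
exists Q => //; split.
  have SM x y : invmx Q *m twist (x * y)%g *m Q =
      (invmx Q *m twist x *m Q) *m (invmx Q *m twist y *m Q).
    by rewrite twistM invmx_conjM.
  apply: (character_ind alphaM m1).
  - by rewrite mE mxOver_mx2 ?rpred0 ?rpred1 // rpredM.
  - suff -> : invmx Q *m twist m^-1%g *m Q = mx2 0 1 (f b^-1 * t ^- 2) 0.
      by rewrite mxOver_mx2 ?rpred0 ?rpred1 // rpredM.
    have bt0 : f b * t ^+ 2 != 0 by rewrite mulf_neq0 ?fmorph_eq0 ?expf_neq0.
    have := mx2_antidiagV bt0; rewrite invfM -fmorphV => mVE.
    rewrite -[LHS]mulmx1 -mVE -mE mulmxA -SM mulVg twist1 invmx_conj1 //.
    by rewrite mul1mx.
  - move=> x x0; have [a [d xP]] := kerP x x0; rewrite (kerE _ _ _ x0 xP).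
    by rewrite mxOver_mx2 ?rpred0.
  - by move=> x y xE yE; rewrite SM mxOverM.
have cE : \det (twist c - 1%:M) = f ((mu - 1) * (nu - 1)).
  rewrite -(det_invmx_conj_sub1 Qu) (kerE _ _ _ c0 cP) mx2_diag_sub1 det_mx2_diag.
  by rewrite rmorphM !rmorphB rmorph1.
exists c; rewrite cE -fmorphV; split=> //.
by rewrite fmorph_eq0 mulf_eq0 !subr_eq0 negb_or mu1.
Qed.

End Twist.

Theorem proposition4p1 (R : realType)
  (K U : set (sphere R 3)) (knotK : is_knot K)
  (tubU : is_open_tubular_neighbourhood K U)
  (x0 : knot_exterior U)
  (rho : fundamental_group R x0 -> 'M[R[i]]_2)
  (rep_rho : is_SL2_representation rho)
  (irr_rho : irreducible_representation rho)
  (metab_rho : metabelian_representation rho)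
  (alpha : fundamental_group R x0 -> int)
  (ab_alpha : is_abelianization alpha)
  (n : nat) (g : 'I_n.+1 -> fundamental_group R x0) (r : 'I_n -> word n.+1)
  (pres : is_presentation g r)
  (l : 'I_n.+1) (alpha_l : alpha (g l) <> 0%R) :
  is_even_laurent_polynomial (twisted_alexander alpha rho g r l).
Proof.
have [Q Qu [QE [c [c0 cE]]]] := twist_even_form (tvar_neq0 R) rep_rho ab_alpha
  irr_rho metab_rho (@const_even R) (tvar2_even R) (tvar2V_even R).
apply: even_laurent_is_even.
exact: (fox_quotient_over l (twist1 _ _ rep_rho ab_alpha)
  (twistM _ (tvar_neq0 R) rep_rho ab_alpha) pres Qu QE c0 cE).
Qed.
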